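(* Every spider with at least 3 legs of odd length is not $e$-positive.
   Context: Given a partition $\lambda=(\lambda_1,\ldots,\lambda_d)$ of $n-1$ with $d\ge 3$ parts, the spider $S(\lambda)=S(\lambda_1,\ldots,\lambda_d)$ is the $n$-vertex tree consisting of $d$ disjoint paths $P_{\lambda_1},\ldots,P_{\lambda_d}$, where $P_k$ denotes the path with $k$ vertices, together with one further vertex (the centre) joined to one end vertex of each path. The paths are the legs, and the $i$-th leg has length $\lambda_i$ (its number of vertices). Chromatic symmetric function and $e$-positivity: a proper colouring of a graph $G$ is a map $\kappa:V_G\to\{1,2,\ldots\}$ with $\kappa(u)\neq\kappa(v)$ whenever $u,v$ are adjacent. If $V_G=\{v_1,\ldots,v_n\}$, the chromatic symmetric function is $X_G=\sum_\kappa x_{\kappa(v_1)}\cdots x_{\kappa(v_n)}\in\mathbb{Q}[[x_1,x_2,\ldots]]$, summed over all proper colourings $\kappa$ of $G$. The elementary symmetric functions are $e_i=\sum_{j_1<\cdots<j_i}x_{j_1}\cdots x_{j_i}$ for $i\ge 1$ and $e_\lambda=e_{\lambda_1}\cdots e_{\lambda_\ell}$ for a partition $\lambda=(\lambda_1,\ldots,\lambda_\ell)$; they form a basis of the algebra of symmetric functions over $\mathbb{Q}$. The graph $G$ is $e$-positive if $X_G$ is a nonnegative linear combination of the $e_\lambda$. *)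

(* Defs.v *)
From HB Require Import structures.
From mathcomp Require Import all_boot all_order all_algebra finmap multiset.
From mathcomp Require Import boolp classical_sets functions cardinality fsbigop.

Set Implicit Arguments.
Unset Strict Implicit.
Unset Printing Implicit Defensive.

Import Order.TTheory GRing.Theory Num.Theory.

Local Open Scope mset_scope.
Local Open Scope classical_set_scope.
Local Open Scope ring_scope.

Record sgraph := SGraph {
  vertex :> finType;
  adj : rel vertex;
  adj_sym : symmetric adj;
  adj_irrefl : irreflexive adj }.

Definition is_part (la : seq nat) : bool := sorted geq la && (0%N \notin la).

(* The ring Q[[x_0, x_1, ...]], the variables being numbered from 0: a monomial
   is the multiset of its variables, and a series is the function giving the
   coefficient of each monomial. *)
Definition monom := {mset nat}.
Definition pseries := monom -> rat.

Definition xmon (s : seq nat) : monom := seq_mset s.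

(* The formal sum of the monomials F i, i \in D.  [\sum_(i \in D) _] is 0 when
   its support is infinite, so D and F have to be such that each monomial is
   reached finitely often; [finite_colourings] and [finite_increasing] below
   show that this holds for [chromsym] and [esym]. *)
Definition sum_monom (I : choiceType) (D : set I) (F : I -> monom) : pseries :=
  fun m => \sum_(i \in D) ((F i == m)%:R : rat).

Definition pone : pseries := fun m => (m == xmon [::])%:R.

(* The Cauchy product; the sum is finite by [finite_splittings] below. *)
Definition pmul (f g : pseries) : pseries :=
  fun m => \sum_(p \in [set p : monom * monom | (p.1 `+` p.2)%mset = m])
             f p.1 * g p.2.

Definition esym (k : nat) : pseries :=
  sum_monom [set s : seq nat | size s = k /\ sorted ltn s] xmon.

Definition esym_part (la : seq nat) : pseries :=
  \big[pmul/pone]_(k <- la) esym k.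

Definition proper_colouring (G : sgraph) (kappa : {ffun G -> nat}) : Prop :=
  forall u v : G, adj u v -> kappa u != kappa v.

Definition chromsym (G : sgraph) : pseries :=
  sum_monom [set kappa | @proper_colouring G kappa]
            (fun kappa : {ffun G -> nat} => xmon [seq kappa v | v : G]).

Definition e_positive (G : sgraph) : Prop :=
  exists (P : seq (seq nat)) (c : seq nat -> rat),
    [/\ all is_part P,
        forall la, la \in P -> 0 <= c la &
        forall m, chromsym G m = \sum_(la <- P) c la * esym_part la m].

(* [None] is the centre; [Some (Tagged _ j)] with tag i is the vertex number j
   of the leg i, and j = 0 is the end of the leg that is joined to the centre. *)
Definition spider_vertex (la : seq nat) : finType :=
  option {i : 'I_(size la) & 'I_(nth 0%N la i)}.

Definition spider_arc (la : seq nat) (u v : spider_vertex la) : bool :=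
  match u, v with
  | None, Some y => nat_of_ord (tagged y) == 0%N
  | Some x, Some y => (tag x == tag y) && (nat_of_ord (tagged y) == (tagged x).+1)
  | _, None => false
  end.

Definition spider_adj (la : seq nat) : rel (spider_vertex la) :=
  fun u v => spider_arc u v || spider_arc v u.

Lemma spider_adj_sym la : symmetric (@spider_adj la).
Proof. by move=> u v; rewrite /spider_adj orbC. Qed.

Lemma spider_adj_irrefl la : irreflexive (@spider_adj la).
Proof.
by case=> [[i j]|]; rewrite /spider_adj /spider_arc //= orbb (ltn_eqF (ltnSn _)) andbF.
Qed.

Definition spider (la : seq nat) : sgraph :=
  SGraph (@spider_adj_sym la) (@spider_adj_irrefl la).

Lemma card_spider la : #|spider la| = (sumn la).+1.
Proof.
rewrite card_option card_tagged; congr _.+1.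
rewrite !sumnE big_map big_enum /= [in RHS](big_nth 0%N) big_mkord.
by apply: eq_bigr => i _; rewrite card_ord.
Qed.

Lemma finite_xmon_fiber (m : monom) : finite_set [set s : seq nat | xmon s = m].
Proof.
apply: (@sub_finite_set _ _ [set` permutations (enum_mset m)]); last first.
  exact: finite_seq.
move=> s /= sm; rewrite mem_permutations -sm perm_sym.
exact: perm_eq_seq_mset.
Qed.

Lemma finite_increasing (k : nat) (m : monom) :
  finite_set ([set s : seq nat | size s = k /\ sorted ltn s] `&`
              [set s | xmon s = m]).
Proof. exact: finite_setIr (finite_xmon_fiber m). Qed.

Lemma finite_colourings (G : sgraph) (m : monom) :
  finite_set ([set kappa | @proper_colouring G kappa] `&`
              [set kappa : {ffun G -> nat} | xmon [seq kappa v | v : G] = m]).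
Proof.
apply: finite_setIr.
pose h (kappa : {ffun G -> nat}) := [seq kappa v | v : G].
have hinj : injective h.
  move=> f g; rewrite /h /image_mem => /eq_in_map fg; apply/ffunP => v.
  by apply: fg; rewrite mem_enum.
have -> : [set kappa : {ffun G -> nat} | xmon [seq kappa v | v : G] = m] =
          h @^-1` [set s | xmon s = m] by [].
apply: finite_preimage; last exact: finite_xmon_fiber.
by move=> f g _ _; apply: hinj.
Qed.

Lemma finite_splittings (m : monom) :
  finite_set [set p : monom * monom | (p.1 `+` p.2)%mset = m].
Proof.
pose sp (t : seq nat * nat) := (xmon (take t.2 t.1), xmon (drop t.2 t.1)).
have fin : finite_set
    (sp @` ([set s | xmon s = m] `*` [set` iota 0%N (size (enum_mset m)).+1])).
  apply/finite_image/finite_setX; first exact: finite_xmon_fiber.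
  exact: finite_seq.
apply: sub_finite_set fin => -[a b] /= abm.
have pE : perm_eq (enum_mset a ++ enum_mset b) (enum_mset m).
  by apply/allP => x _ /=; rewrite count_cat !count_mem_mset -abm msetE2 eqxx.
exists (enum_mset a ++ enum_mset b, size (enum_mset a)).
  split=> /=; first by rewrite -[RHS]seq_mset_id; apply/eq_seq_msetP.
  change (size (enum_mset a) \in iota 0%N (size (enum_mset m)).+1).
  by rewrite mem_iota leq0n add0n ltnS -(perm_size pE) size_cat leq_addr.
by rewrite /sp /= take_size_cat // drop_size_cat // /xmon !seq_mset_id.
Qed.

(* Main.v *)
Require Import Defs.
From mathcomp Require Import all_boot all_order all_algebra finmap multiset.
From mathcomp Require Import boolp classical_sets cardinality fsbigop.
From mathcomp Require Import ring algC.

(** Evaluate the series at finitely many algebraic numbers x_1, ..., x_N (all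
    other variables being 0).  If every e_k(x) is nonnegative, then so is the
    value of any nonnegative combination of the e_mu ([e_positive_ge0]).  So it
    suffices to find a point x with all e_k(x) >= 0 and X_G(x) < 0.

    For a tree on n vertices, X_G is the sum over the sets S of edges of
    (-1)^|S| p_S, where p_S is the product of the power sums p_c over the sizes
    c of the components of S.  At a point where p_1 = e, p_2 = -1 and p_k = 0
    for 2 < k < n, only two kinds of S survive: each matching M contributes
    e^(n - 2|M|), and the set of all the edges contributes (-1)^(n-1) p_n.  The
    last power sum is still free, and it is chosen so that e_n(x) = 0.  By Newton's identities the e_k(x) with k < n
    are then the nonnegative numbers a_k of [ecoef], and (-1)^(n-1) p_n = - n
    a_n, where a_n is the value that e_n would have if p_n were 0.  Hence

      X_G(x) = (sum over the matchings M of G of e^(n - 2|M|)) - n a_n.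

    Let e > 0 tend to 0.  For e <= 1 the number a_n is at least e / n!
    ([ecoef_ge]).  In a spider with at least 3 odd legs, at most one of these
    legs is matched to the centre, each of the others has an uncovered vertex,
    and so the sum over the matchings is O(e^2).  Therefore X_G(x) < 0 for some
    small e > 0 ([exists_small_parameter]).

    A point x with prescribed e_k(x) exists because a polynomial with constant
    term 1 over an algebraically closed field is a product of factors 1 + x_i t
    ([exists_esym_gen]).  The value X_G(x) is not computed from the expansion
    over sets of edges but by colouring the centre first: the colourings of a
    leg with l vertices, given the colour c of the centre, sum up to
    Q_l(- x_c) for an explicit monic polynomial Q_l of degree l
    ([legsum_legpoly]), so that X_G(x) is the sum over c of x_c Q(- x_c), Q
    being the product of the Q_l over the legs.  The coefficient of Q in degree
    m is multiplied by (-1)^m p_(m+1) in this sum, so that only the degrees 0, 1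
    and n - 1 matter ([sum_horner_ecoef]). *)

Set Implicit Arguments.
Unset Strict Implicit.
Unset Printing Implicit Defensive.

Import Order.TTheory GRing.Theory Num.Theory.

Local Open Scope ring_scope.

(** * Points with prescribed elementary symmetric functions *)

(** The generating function of the elementary symmetric functions of [xs]. *)
Definition esym_gen (R : comNzRingType) (xs : seq R) : {poly R} :=
  \prod_(z <- xs) (1 + z *: 'X).

(** The power sums are shifted by one and carry signs, so as to be the first
    [n] coefficients of the logarithmic derivative of [esym_gen xs]. *)
Definition psum_gen (R : comNzRingType) (n : nat) (xs : seq R) : {poly R} :=
  \poly_(k < n) ((- 1) ^+ k * \sum_(z <- xs) z ^+ k.+1).

(** With E the generating function of the e_k, E' / E is the sum over z in [xs]
    of z / (1 + z t), and each of these fractions is a geometric series, which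
    is truncated here at degree [n] without dividing. *)
Lemma newton_identities (R : comNzRingType) (n : nat) (xs : seq R) :
  exists h, (esym_gen xs)^`() = esym_gen xs * psum_gen n xs + 'X^n * h.
Proof.
elim: xs => [|z xs [h IH]].
  exists 0; rewrite /esym_gen /psum_gen big_nil derivC mulr0 addr0 mul1r.
  by apply/polyP => k; rewrite coef_poly big_nil mulr0 coef0 if_same.
have -> : esym_gen (z :: xs) = (1 + z *: 'X) * esym_gen xs.
  by rewrite /esym_gen big_cons.
have -> : psum_gen n (z :: xs)
        = z%:P * (\sum_(k < n) (- z *: 'X) ^+ k) + psum_gen n xs.
  rewrite /psum_gen !poly_def mulr_sumr -big_split /=; apply: eq_bigr => k _.
  rewrite big_cons mulrDr scalerDl exprZn -!mul_polyC mulrA -polyCM.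
  by congr (_%:P * _ + _); rewrite exprS (exprNn z); ring.
have geo : (1 + z *: 'X) * (\sum_(k < n) (- z *: 'X) ^+ k)
         = 1 - (- z *: 'X) ^+ n.
  rewrite -[RHS]opprB subrX1 -mulNr; congr (_ * _).
  by rewrite opprB scaleNr opprK.
rewrite derivM derivD derivC add0r derivZ derivX IH.
exists ((1 + z *: 'X) * h + z%:P * esym_gen xs * (- z)%:P ^+ n).
have E : (- z *: 'X : {poly R}) ^+ n = (- z)%:P ^+ n * 'X^n.
  by rewrite exprZn -mul_polyC rmorphXn.
rewrite E in geo.
have -> : z *: 1 = z%:P :> {poly R} by rewrite alg_polyC.
set S := \sum_(k < n) _ in geo *.
transitivity (z%:P * esym_gen xs * (1 - (- z)%:P ^+ n * 'X^n)
  + (1 + z *: 'X) * (esym_gen xs * psum_gen n xs + 'X^n * h)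
  + z%:P * esym_gen xs * (- z)%:P ^+ n * 'X^n); first by ring.
by rewrite -geo; ring.
Qed.

(** The constant term 1 excludes the root 0, so that every factor X - r can be
    divided by - r. *)
Lemma exists_esym_gen (F : closedFieldType) (A : {poly F}) :
  A`_0 = 1 -> exists xs, esym_gen xs = A.
Proof.
move=> A0; have [r Ar] := closed_field_poly_normal A.
have Aval : A.[0] = 1 by rewrite horner_coef0.
have rn0 z : z \in r -> z != 0.
  move=> zr; apply/eqP => z0; have: root A 0.
    rewrite Ar rootZ; first by rewrite root_prod_XsubC -z0.
    rewrite lead_coef_eq0; apply: contra_eq_neq A0 => ->.
    by rewrite coef0 eq_sym oner_eq0.
  by rewrite /root Aval oner_eq0.
exists [seq - z^-1 | z <- r].
rewrite /esym_gen big_map.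
have E : \prod_(z <- r) ('X - z%:P) =
    (\prod_(z <- r) - z)%:P * \prod_(z <- r) (1 + - z^-1 *: 'X) :> {poly F}.
  rewrite rmorph_prod /= -big_split /=; apply: eq_big_seq => z /rn0 zn0.
  rewrite mulrDr mulr1 mul_polyC scalerA mulrNN divff // scale1r polyCN.
  by rewrite addrC.
rewrite E mul_polyC scalerA in Ar.
set c := _ * _ in Ar; suff c1 : c = 1 by rewrite Ar c1 scale1r.
rewrite Ar coefZ -horner_coef0 horner_prod big1_seq ?mulr1 // in A0 => z _.
by rewrite !hornerE ?mulr0 ?addr0.
Qed.

(** The coefficients of exp (e t + t^2 / 2), that is, the values of the
    elementary symmetric functions when p_1 = e, p_2 = -1 and all the other
    power sums are 0; the recurrence is Newton's identity. *)
Fixpoint ecoef (F : fieldType) (e : F) (k : nat) : F :=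
  match k with
  | 0 => 1
  | k'.+1 => match k' with
             | 0 => e
             | k''.+1 => (e * ecoef e k' + ecoef e k'') / k%:R
             end
  end.

Arguments ecoef : simpl never.

Lemma ecoefSS (F : fieldType) (e : F) k :
  ecoef e k.+2 = (e * ecoef e k.+1 + ecoef e k) / k.+2%:R.
Proof. by []. Qed.

Lemma ecoef_ge0 (F : numFieldType) (e : F) k : 0 <= e -> 0 <= ecoef e k.
Proof.
move=> e0; suff: (0 <= ecoef e k) && (0 <= ecoef e k.+1) by case/andP.
elim: k => [|k /andP[h1 h2]]; first by rewrite /ecoef ler01 e0.
by rewrite h2 ecoefSS mulr_ge0 ?invr_ge0 ?ler0n // addr_ge0 // mulr_ge0.
Qed.

(** Being at least linear in [e] is what makes a spider fail: the matchings
    only contribute to the order e^2. *)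
Lemma ecoef_ge (F : numFieldType) (e : F) k : 0 <= e -> e <= 1 ->
  e / k`!%:R <= ecoef e k.
Proof.
move=> e0 e1.
suff: (e / k`!%:R <= ecoef e k) && (e / k.+1`!%:R <= ecoef e k.+1).
  by case/andP.
elim: k => [|k /andP[h1 h2]]; first by rewrite fact0 !divr1 /ecoef e1 lexx.
rewrite h2 ecoefSS factS natrM invfM mulrCA mulrC.
apply: ler_wpM2r; first by rewrite invr_ge0 ler0n.
apply: le_trans (_ : ecoef e k <= _); last by rewrite lerDr mulr_ge0 ?ecoef_ge0.
apply: le_trans h1; rewrite ler_wpM2l // lef_pV2 ?posrE ?ltr0n ?fact_gt0 //.
by rewrite ler_nat factS leq_pmull.
Qed.

Lemma dvdp_Xn_coef (F : fieldType) n (p : {poly F}) :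
  (forall k, (k < n)%N -> p`_k = 0) -> 'X^n %| p.
Proof.
move=> p0; rewrite -[p](poly_take_drop n).
have -> : take_poly n p = 0.
  by apply/polyP => k; rewrite coef_take_poly coef0; case: ifP => // /p0.
by rewrite add0r dvdp_mulIr.
Qed.

(** Cutting off the [ecoef] at degree [n], which makes e_n vanish, leaves the
    power sums p_1, ..., p_(n-1) unchanged and moves the whole defect into p_n.
    Both sides of the equation become equal modulo 'X^n once multiplied by the
    generating function of the e_k, which is invertible modulo 'X^n. *)
Lemma psum_gen_ecoef (F : numFieldType) (e : F) n (xs : seq F) : (2 < n)%N ->
  esym_gen xs = \poly_(k < n) ecoef e k ->
  psum_gen n xs = e%:P + 'X - (n%:R * ecoef e n) *: 'X^(n.-1).
Proof.
case: n => [//|[//|[//|n]]] _ Axs; set N := n.+3 in Axs *.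
have [h Nh] := newton_identities N xs; move: Nh; rewrite Axs.
set A := \poly_(k < N) _; set g := psum_gen N xs => Nh; set G := RHS.
apply/eqP; rewrite -subr_eq0; apply/negPn/negP => gG.
have A0 : A`_0 = 1 by rewrite coef_poly.
have dv : 'X^N %| A * (g - G).
  have -> : A * (g - G) = (A^`() - A * G) - 'X^N * h.
    by rewrite Nh mulrBr addrAC addrK.
  apply: dvdp_sub; last exact: dvdp_mulIl.
  apply: dvdp_Xn_coef => k kN.
  have -> : A * G = e *: A + A * 'X - (N%:R * ecoef e N) *: (A * 'X^(N.-1)).
    by rewrite /G mulrBr mulrDr -scalerAr [A * _%:P]mulrC mul_polyC.
  rewrite !coefB coefD coef_deriv !coefZ coefMX coefMXn !coef_poly kN.
  case: k kN => [|k] kN /=.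
    by rewrite mulr0 mulr1 addr0 subr0 mulr1n subrr.
  rewrite (ltnW kN) -[_ *+ k.+2]mulr_natl; have [kn|] := ltnP k.+2 N.
    rewrite -ltnS kn ecoefSS mulr0 subr0.
    by rewrite mulrC divfK ?pnatr_eq0 // subrr.
  (* In degree N - 1 the derivative of the truncated series has coefficient 0
     instead of the N a_N of the recurrence; the last term of G cancels it. *)
  move=> Nk'; have Nk : N = k.+2 by apply/eqP; rewrite eqn_leq Nk'.
  have -> : (k.+1 < n.+2)%N = false by rewrite -ltnS -Nk ltnn.
  have -> : (k.+1 - n.+2 = 0)%N by rewrite -[n.+2]/(N.-1) Nk subnn.
  rewrite Nk ecoefSS /ecoef mulr1 mulr0 sub0r -/ecoef [k.+2%:R * _]mulrC.
  by rewrite divfK ?pnatr_eq0 //; ring.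
have cop : coprimep ('X^N) A.
  rewrite coprimep_expl // coprimep_sym coprimepX.
  by rewrite /root horner_coef0 A0 oner_eq0.
rewrite Gauss_dvdpr // in dv; have := dvdp_leq gG dv.
rewrite size_polyXn ltnNge => /negP; apply.
rewrite (leq_trans (size_polyD _ _)) // geq_max size_poly size_polyN /=.
rewrite (leq_trans (size_polyD _ _)) // geq_max size_polyN.
rewrite (leq_trans (size_polyD _ _)) /=; last first.
  by rewrite geq_max size_polyX size_polyC (leq_trans (leq_b1 _)).
by rewrite (leq_trans (size_scale_leq _ _)) // size_polyXn.
Qed.

Lemma sum_horner_psum (R : comNzRingType) (n : nat) (xs : seq R)
    (q : {poly R}) :
  (size q <= n)%N ->
  \sum_(z <- xs) z * q.[- z] = \sum_(k < n) q`_k * (psum_gen n xs)`_k.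
Proof.
move=> qn; under eq_bigr do rewrite (horner_coef_wide _ qn) mulr_sumr.
rewrite exchange_big; apply: eq_bigr => k _; rewrite coef_poly ltn_ord /=.
rewrite mulrA mulr_sumr; apply: eq_bigr => z _; rewrite (exprNn z) exprS; ring.
Qed.

(** The linear functional by which a colour sum over one vertex is evaluated:
    it sends 'X^m to (-1)^m p_(m+1), and hence sees three coefficients only. *)
Lemma sum_horner_ecoef (F : numFieldType) (e : F) n (xs : seq F)
    (q : {poly F}) :
  (2 < n)%N -> esym_gen xs = \poly_(k < n) ecoef e k -> (size q <= n)%N ->
  \sum_(z <- xs) z * q.[- z] = e * q`_0 + q`_1 - n%:R * ecoef e n * q`_n.-1.
Proof.
move=> n2 Axs qn; rewrite (sum_horner_psum xs qn) (psum_gen_ecoef n2 Axs).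
under eq_bigr => k _ do
  rewrite coefB coefD coefC coefX coefZ coefXn mulrBr mulrDr mulrCA.
case: n n2 {Axs} qn => [//|[//|[//|n]]] _ qn.
rewrite big_split big_split /= sumrN; congr (_ + _ - _).
- by rewrite big_ord_recl /= big1 ?addr0 1?mulrC // => k _; rewrite mulr0.
- rewrite big_ord_recl big_ord_recl /= mulr0 add0r mulr1 big1 ?addr0 // => k _.
  by rewrite mulr0.
rewrite big_ord_recr /= eqxx mulr1 big1 ?add0r // => k _.
by rewrite ltn_eqF ?mulr0.
Qed.

(** * Matching polynomials of the legs *)

(** The sum of e^(k - 2|M|) over the matchings M of the path with [k] vertices:
    an end vertex is either uncovered or matched to its neighbour. *)
Fixpoint path_matching (R : nzRingType) (e : R) (k : nat) : R :=
  match k with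
  | 0 => 1
  | k'.+1 => match k' with
             | 0 => e
             | k''.+1 => e * path_matching e k' + path_matching e k''
             end
  end.

Arguments path_matching : simpl never.

(** The polynomial Q_k with coefficient [path_matching e (k - j)] in degree j:
    by inclusion and exclusion over monochromatic edges, 'X^j accounts for the
    first j edges, counted from the centre, being in the set and the next one
    not; at - x_c it has the sign (-1)^j of these edges. *)
Fixpoint legpoly (R : nzRingType) (e : R) (k : nat) : {poly R} :=
  match k with
  | 0 => 1
  | k'.+1 => (path_matching e k)%:P + legpoly e k' * 'X
  end.

Lemma path_matchingSS (R : nzRingType) (e : R) k :
  path_matching e k.+2 = e * path_matching e k.+1 + path_matching e k.
Proof. by []. Qed.

Lemma size_legpoly (R : nzRingType) (e : R) k : size (legpoly e k) = k.+1.
Proof.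
elim: k => [|k IH] /=; first exact: size_poly1.
have sX : size (legpoly e k * 'X) = k.+2.
  by rewrite size_mulX ?IH // -size_poly_eq0 IH.
by rewrite addrC size_polyDl sX // size_polyC; case: eqP.
Qed.

Lemma monic_legpoly (R : nzRingType) (e : R) k : legpoly e k \is monic.
Proof.
elim: k => [|k IH] /=; first exact: monic1.
have sX : size (legpoly e k * 'X) = k.+2.
  by rewrite size_mulX ?size_legpoly // -size_poly_eq0 size_legpoly.
rewrite monicE addrC lead_coefDl ?lead_coefMX -?monicE // sX.
by rewrite size_polyC; case: eqP.
Qed.

Lemma coef0_legpoly (R : nzRingType) (e : R) k :
  (legpoly e k)`_0 = path_matching e k.
Proof. by case: k => [|k] /=; rewrite ?coefC // coefD coefC coefMX addr0. Qed.

Lemma coef1_legpoly (R : nzRingType) (e : R) k :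
  (legpoly e k.+1)`_1 = path_matching e k.
Proof. by rewrite /= coefD coefC coefMX add0r coef0_legpoly. Qed.

(** A matching of a path with an odd number of vertices leaves at least one of
    them uncovered, whence the factor [e]. *)
Lemma path_matching_bounds (R : numDomainType) (e : R) k : 0 <= e <= 1 ->
  0 <= path_matching e k <= e ^+ odd k * 2 ^+ k.
Proof.
case/andP=> e0 e1; pose P k := 0 <= path_matching e k <= e ^+ odd k * 2 ^+ k.
suff: P k /\ P k.+1 by case.
elim: k => [|k [IH1 IH2]].
  by rewrite /P /path_matching /= !mul1r ler01 lexx e0 ler_peMr // ler1n.
split=> //; case/andP: IH1 IH2 => p0 p1 /andP[q0 q1].
rewrite /P path_matchingSS addr_ge0 ?mulr_ge0 //=.
have ee : e * e ^+ odd k.+1 <= e ^+ odd k.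
  rewrite -exprS /=; case: odd => /=; first by [].
  by rewrite mulr_ile1.
apply: le_trans (lerD (ler_wpM2l e0 q1) p1) _.
rewrite mulrA; apply: le_trans (lerD (ler_wpM2r _ ee) (lexx _)) _.
  by rewrite exprn_ge0 ?ler0n.
rewrite negbK -mulrDr ler_wpM2l ?exprn_ge0 //.
by rewrite [2 ^+ k.+2]exprS mulr_natl [leRHS]mulr2n lerD2l ler_weXn2l ?ler1n.
Qed.

(** The coefficient in degree 0 sums over the matchings that leave the centre
    uncovered, the one in degree 1 over those that match it to a leg; the
    latter can use up one of the odd legs, hence the predecessor. *)
Lemma prod_legpoly_bounds (R : numDomainType) (e : R) (la : seq nat)
    (q := \prod_(l <- la) legpoly e l) : 0 <= e <= 1 ->
  q`_0 <= e ^+ count odd la * 2 ^+ sumn la /\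
  q`_1 <= (size la)%:R * e ^+ (count odd la).-1 * 2 ^+ sumn la.
Proof.
move=> e01; case/andP: (e01) => e0 e1.
suff: (0 <= q`_0 <= e ^+ count odd la * 2 ^+ sumn la) /\
  (0 <= q`_1 <= (size la)%:R * e ^+ (count odd la).-1 * 2 ^+ sumn la).
  by case=> /andP[_ ->] /andP[_ ->].
rewrite /q {q}; elim: la => [|l la].
  by rewrite big_nil !coef1 /= !expr0 ?mulr1 ?mul1r ?mul0r !lexx ler01.
rewrite big_cons; set p := \prod_(_ <- la) _ => -[/andP[p0 p0b] /andP[p1 p1b]].
have c0 : (legpoly e l * p)`_0 = path_matching e l * p`_0.
  by rewrite -!horner_coef0 hornerM !horner_coef0 coef0_legpoly.
have c1 : (legpoly e l * p)`_1 =
    path_matching e l * p`_1 + (legpoly e l)`_1 * p`_0.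
  by rewrite coefM !big_ord_recl big_ord0 addr0 /= coef0_legpoly.
have /andP[l0 l0b] := path_matching_bounds l e01.
have /andP[l1 l1b] : 0 <= (legpoly e l)`_1 <= 2 ^+ l.
  case: l {c0 c1 l0 l0b} => [|l]; first by rewrite coef1 /= lexx exprn_ge0.
  rewrite coef1_legpoly; have /andP[-> h] := path_matching_bounds l e01.
  apply: le_trans h _; rewrite exprS ler_pM ?exprn_ge0 //.
    by rewrite (le_trans (exprn_ile1 _ _ _)) ?ler1n.
rewrite c0 c1 /= exprD [2 ^+ (l + _)]exprD; split.
  rewrite mulr_ge0 //= mulrACA ler_pM //.
rewrite addr_ge0 ?mulr_ge0 //= -[(size la).+1%:R]natr1 !mulrDl lerD //.
  apply: le_trans (ler_pM l0 p1 l0b p1b) _.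
  rewrite [leLHS](_ : _ = (size la)%:R * (e ^+ odd l * e ^+ (count odd la).-1) *
    (2 ^+ l * 2 ^+ sumn la)); last by ring.
  rewrite ler_wpM2r ?mulr_ge0 ?exprn_ge0 // ler_wpM2l // -exprD.
  by rewrite ler_wiXn2l //; case: odd (count odd la) => [] [].
apply: le_trans (ler_pM l1 p0 l1b p0b) _.
rewrite mul1r [leLHS]mulrCA ler_wpM2r ?mulr_ge0 ?exprn_ge0 //.
by rewrite ler_wiXn2l //; case: odd (count odd la) => [] [].
Qed.

(** * Evaluation of series at a point *)

(** The values of a colouring being natural numbers, only this version with
    finitely many colours can be summed over. *)
Definition proper_on (G : sgraph) (K : finType) (kappa : {ffun G -> K}) :=
  [forall u, forall v, adj u v ==> (kappa u != kappa v)].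

Definition meval (R : numFieldType) (x : nat -> R) (m : monom) : R :=
  \prod_(i <- enum_mset m) x i.

Lemma meval_xmon (R : numFieldType) (x : nat -> R) s :
  meval x (xmon s) = \prod_(i <- s) x i.
Proof. exact/perm_big/perm_eq_seq_mset. Qed.

Lemma mevalD (R : numFieldType) (x : nat -> R) (a b : monom) :
  meval x (a `+` b)%mset = meval x a * meval x b.
Proof.
rewrite /meval -big_cat; apply: perm_big.
by apply/allP => i _ /=; rewrite count_cat !count_mem_mset msetE2 eqxx.
Qed.

(** The value v of a series f at x.  The list [l] stands for the finite sum of
    the t.1 * t.2, which has to agree with f on the monomials that do not
    vanish at x; at a point with finitely many nonzero coordinates these are
    the only ones that matter, and f itself may be infinite. *)
Definition evaluates (R : numFieldType) (x : nat -> R) (f : pseries) (v : R) :=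
  exists l : seq (rat * monom),
    (forall m, meval x m != 0 -> f m = \sum_(t <- l) t.1 * (t.2 == m)%:R) /\
    v = \sum_(t <- l) ratr t.1 * meval x t.2.

Lemma evaluates_ext (R : numFieldType) (x : nat -> R) f v w :
  evaluates x f v -> v = w -> evaluates x f w.
Proof. by move=> h <-. Qed.

Lemma evaluates_inj (R : numFieldType) (x : nat -> R) f v w :
  evaluates x f v -> evaluates x f w -> v = w.
Proof.
move=> [l [fl ->]] [k [fk ->]].
(* Collecting equal monomials turns the value into a sum over coefficients. *)
have E (l' ms : seq _) :
    uniq ms -> {subset [seq t.2 | t : rat * monom <- l'] <= ms} ->
  \sum_(t <- l') ratr t.1 * meval x t.2 =
  \sum_(m <- ms) ratr (\sum_(t <- l') t.1 * (t.2 == m)%:R) * meval x m.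
  move=> ums lms.
  under [RHS]eq_bigr do rewrite rmorph_sum mulr_suml.
  rewrite exchange_big /=; apply: eq_big_seq => t tl.
  rewrite (bigD1_seq t.2) ?lms ?map_f //= eqxx mulr1 big1 ?addr0 // => m mt.
  by rewrite eq_sym (negPf mt) mulr0 rmorph0 mul0r.
pose ms := undup [seq t.2 | t <- l ++ k].
rewrite (E l ms) ?(E k ms) ?undup_uniq //.
- apply: eq_bigr => m _.
  have [->|mn0] := eqVneq (meval x m) 0; first by rewrite !mulr0.
  by rewrite -fl // -fk.
- by move=> m mk; rewrite mem_undup map_cat mem_cat mk orbT.
- by move=> m mk; rewrite mem_undup map_cat mem_cat mk.
Qed.

Lemma evaluates_sum (R : numFieldType) (x : nat -> R) (I : Type) (r : seq I)
    (c : I -> rat) (f : I -> pseries) (v : I -> R) :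
  (forall i, evaluates x (f i) (v i)) ->
  evaluates x (fun m => \sum_(i <- r) c i * f i m)
    (\sum_(i <- r) ratr (c i) * v i).
Proof.
move=> fv; elim: r => [|i r [l [fl vl]]].
  by exists [::]; split=> [m _|]; rewrite !big_nil.
have [k [fk vk]] := fv i.
exists ([seq (c i * t.1, t.2) | t <- k] ++ l); split=> [m mx|].
  rewrite big_cons big_cat big_map fl // fk // mulr_sumr; congr (_ + _).
  by apply: eq_bigr => t _; rewrite mulrA.
rewrite big_cons big_cat big_map vl vk mulr_sumr; congr (_ + _).
by apply: eq_bigr => t _; rewrite /= rmorphM mulrA.
Qed.

Lemma evaluates_one (R : numFieldType) (x : nat -> R) : evaluates x pone 1.
Proof.
exists [:: (1, xmon [::])]; split=> [m _|]; rewrite big_seq1 /=.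
  by rewrite mul1r eq_sym.
by rewrite rmorph1 mul1r meval_xmon big_nil.
Qed.

(** If a product of two monomials does not vanish at x, then neither factor
    does; so the Cauchy product only involves coefficients for which the two
    lists are reliable. *)
Lemma evaluates_mul (R : numFieldType) (x : nat -> R) f g v w :
  evaluates x f v -> evaluates x g w -> evaluates x (pmul f g) (v * w).
Proof.
move=> [l [fl ->]] [k [gk ->]].
exists [seq (t.1 * u.1, (t.2 `+` u.2)%mset) | t <- l, u <- k].
split; last first.
  rewrite big_allpairs_dep mulr_suml; apply: eq_bigr => t _; rewrite mulr_sumr.
  by apply: eq_bigr => u _ /=; rewrite rmorphM mevalD mulrACA.
move=> m mx; rewrite big_allpairs_dep /pmul.
set D := [set p | _]%classic; have Dfin : finite_set D := finite_splittings m.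
have fgE p : p \in D -> f p.1 * g p.2 = \sum_(t <- l) \sum_(u <- k)
    (t.1 * (t.2 == p.1)%:R) * (u.1 * (u.2 == p.2)%:R).
  rewrite inE /= => pm; move: mx; rewrite -pm mevalD mulf_eq0 negb_or.
  case/andP => x1 x2; rewrite fl // gk // mulr_suml.
  by apply: eq_bigr => t _; rewrite mulr_sumr.
rewrite (@eq_fsbigr _ _ _ _ _ _ _ fgE) fsbig_finite // exchange_big.
apply: eq_bigr => t _; rewrite exchange_big; apply: eq_bigr => u _ /=.
have inD : ((t.2, u.2) \in fset_set D) = ((t.2 `+` u.2)%mset == m).
  by rewrite in_fset_set //; apply/idP/eqP; rewrite inE.
case: eqP inD => tum inD; last first.
  rewrite mulr0 big1_seq // => -[p q] /andP[_ pqD] /=.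
  have [tp|] := eqVneq t.2 p; last by rewrite mulr0 mul0r.
  have [uq|] := eqVneq u.2 q; last by rewrite !mulr0.
  by rewrite -tp -uq inD in pqD.
rewrite (bigD1_seq (t.2, u.2)) ?inD ?fset_uniq //= !eqxx !mulr1 big1 ?addr0 //.
move=> [p q] pq /=; have [tp|] := eqVneq t.2 p; last by rewrite mulr0 mul0r.
have [uq|] := eqVneq u.2 q; last by rewrite !mulr0.
by rewrite -tp -uq eqxx in pq.
Qed.

(** The list [r] has to contain the indices whose monomial does not vanish at
    x; the other indices may be infinite in number. *)
Lemma evaluates_sum_monom (R : numFieldType) (x : nat -> R) (I : choiceType)
    (D : set I) (F : I -> monom) (r : seq I) :
  uniq r -> (forall i, i \in r -> D i) ->
  (forall i, D i -> i \notin r -> meval x (F i) = 0) ->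
  evaluates x (sum_monom D F) (\sum_(i <- r) meval x (F i)).
Proof.
move=> ur rD Dr; exists [seq (1, F i) | i <- r]; split=> [m mx|]; last first.
  by rewrite big_map; apply: eq_bigr => i _ /=; rewrite rmorph1 mul1r.
rewrite big_map /sum_monom (fsbigE r) //.
  rewrite [LHS]big_seq_cond [RHS]big_seq_cond; apply: eq_big => [i|i _] /=.
    by rewrite !andbT; case ir: (i \in r); rewrite //= ?mem_set //; apply: rD.
  by rewrite mul1r.
move=> i Di ir; case: eqP => // Fi; move: mx.
by rewrite -Fi Dr ?eqxx.
Qed.

Lemma coef_esym_gen (R : comNzRingType) (xs : seq R) k :
  (esym_gen xs)`_k =
  \sum_(A : {set 'I_(size xs)} | #|A| == k) \prod_(i in A) xs`_i.
Proof.
rewrite /esym_gen (big_nth 0) big_mkord.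
under eq_bigr do rewrite addrC.
rewrite bigA_distr coef_sum [RHS]big_mkcond; apply: eq_bigr => A _.
rewrite -big_mkcond /=.
under eq_bigr do rewrite -mul_polyC.
rewrite big_split /= -rmorph_prod prodr_const mul_polyC coefZ coefXn eq_sym.
by case: eqP; rewrite ?mulr1 ?mulr0.
Qed.

(** A strictly increasing sequence of variables whose product does not vanish
    at [xs] lists a subset of the indices of [xs]. *)
Lemma evaluates_esym (R : numFieldType) (xs : seq R) k :
  evaluates (nth 0 xs) (Defs.esym k) (esym_gen xs)`_k.
Proof.
pose incr (A : {set 'I_(size xs)}) := [seq val i | i <- enum A].
pose r := [seq incr A | A <- enum [set A : {set 'I_(size xs)} | #|A| == k]].
have incr_sorted A : sorted ltn (incr A).
  rewrite /incr sorted_map; apply: sorted_filter.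
    by move=> ? ? ?; apply: ltn_trans.
  by rewrite -enumT -sorted_map val_enum_ord iota_ltn_sorted.
have incr_inj : injective incr.
  move=> A B /(inj_map val_inj) AB; apply/setP => i.
  by rewrite -mem_enum AB mem_enum.
apply: evaluates_ext (@evaluates_sum_monom _ _ _ _ _ r _ _ _) _.
- by rewrite map_inj_uniq // enum_uniq.
- move=> s /mapP[A]; rewrite mem_enum inE => /eqP Ak -> /=.
  by rewrite size_map -cardE.
- move=> s [sk ss] sr; rewrite meval_xmon.
  have [sx|/allPn[i si ix]] :=
    boolP (all (fun i => i < size xs)%N s); last first.
    by rewrite (big_rem i) //= nth_default ?mul0r // leqNgt.
  pose A := [set i : 'I_(size xs) | val i \in s].
  have sA : s = incr A.
    apply: (irr_sorted_eq ltn_trans ltnn) => // i; apply/idP/mapP => [si|].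
      by exists (Ordinal (allP sx i si)); rewrite // mem_enum inE.
    by case=> j; rewrite mem_enum inE => js ->.
  case/negP: sr; apply/mapP; exists A => //.
  by rewrite mem_enum inE cardE -(size_map val) -/(incr A) -sA sk.
rewrite coef_esym_gen big_map big_enum /=; apply: eq_big => [A|A _].
  by rewrite inE.
by rewrite meval_xmon big_map big_enum.
Qed.

Lemma evaluates_esym_part (R : numFieldType) (xs : seq R) la :
  evaluates (nth 0 xs) (esym_part la) (\prod_(k <- la) (esym_gen xs)`_k).
Proof.
rewrite /esym_part; elim: la => [|k la IH].
  by rewrite !big_nil; apply: evaluates_one.
by rewrite !big_cons; apply: evaluates_mul => //; apply: evaluates_esym.
Qed.

Lemma evaluates_chromsym (R : numFieldType) (xs : seq R) (G : sgraph) :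
  evaluates (nth 0 xs) (chromsym G)
   (\sum_(kappa : {ffun G -> 'I_(size xs)} | proper_on kappa)
      \prod_v xs`_(kappa v)).
Proof.
pose forget (kappa : {ffun G -> 'I_(size xs)}) := [ffun v => val (kappa v)].
pose r := [seq forget kappa | kappa <- enum (@proper_on G 'I_(size xs))].
have forget_inj : injective forget.
  move=> f g /ffunP fg; apply/ffunP => v; apply/val_inj.
  by have := fg v; rewrite !ffunE.
apply: evaluates_ext (@evaluates_sum_monom _ _ _ _ _ r _ _ _) _.
- by rewrite map_inj_uniq // enum_uniq.
- move=> _ /mapP[k + ->]; rewrite mem_enum => kp u v uv.
  by rewrite !ffunE; have /forallP/(_ u)/forallP/(_ v)/implyP/(_ uv) := kp.
- move=> kap kp; rewrite meval_xmon big_map big_enum /=.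
  have [/forallP sx|/forallPn[v vx] _] :=
    boolP [forall v, kap v < size xs]%N; last first.
    by rewrite (bigD1 v) //= nth_default ?mul0r // leqNgt.
  case/negP; apply/mapP; exists [ffun v => Ordinal (sx v)].
    rewrite mem_enum; apply/forallP => u; apply/forallP => v.
    apply/implyP => uv; by rewrite !ffunE; apply: kp.
  by apply/ffunP => v; rewrite !ffunE.
rewrite big_map big_enum /=; apply: eq_bigr => kap _.
by rewrite meval_xmon big_map big_enum; apply: eq_bigr => v _; rewrite ffunE.
Qed.

Lemma e_positive_ge0 (F : numFieldType) (xs : seq F) (G : sgraph) (v : F) :
  e_positive G -> (forall k, 0 <= (esym_gen xs)`_k) ->
  evaluates (nth 0 xs) (chromsym G) v -> 0 <= v.
Proof.
move=> [P [c [_ c_ge0 Xe]]] xs_ge0.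
rewrite (_ : chromsym G =
  fun m => \sum_(mu <- P) c mu * esym_part mu m); last first.
  exact/boolp.funext.
have ev := @evaluates_sum _ _ _ P c _ _ (@evaluates_esym_part _ xs).
move/(evaluates_inj ev) => <-; rewrite big_seq sumr_ge0 // => mu muP.
by rewrite mulr_ge0 ?ler0q ?c_ge0 // prodr_ge0.
Qed.

(** * Colourings of a spider *)

(** Distributivity when the range of summation depends on the factor. *)
Lemma prod_sum_fprod (R : comNzRingType) (I : finType) (T_ : I -> finType)
    (P_ : forall i, T_ i -> R) :
  \prod_i \sum_(j : T_ i) P_ i j = \sum_(h : fprod T_) \prod_i P_ i (h i).
Proof.
pose Q i := [ffun j => P_ i j] : {ffun T_ i -> R}.
transitivity (\sum_(h : fprod T_) \prod_(i in I) Q i (h i)); last first.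
  by apply: eq_bigr => h _; apply: eq_bigr => i _; rewrite ffunE.
rewrite (@big_fprod R 0 1 *%R +%R I T_ Q).
rewrite -(@bigA_distr_big_dep R 0 1 *%R +%R I {i : I & T_ i}
  (fun i => tagged_with T_ i) (fun i => untag 0 (Q i))).
apply: eq_bigr => i _; rewrite -[RHS](big_tag (fun i => Q i)).
by apply: eq_bigr => j _; rewrite ffunE.
Qed.

(** The tuple lists the colours of a leg from the centre, coloured [c],
    outwards. *)
Definition legsum (R : comNzRingType) (K : finType) (w : K -> R) (k : nat)
    (c : K) : R :=
  \sum_(t : k.-tuple K | path (fun a b => a != b) c t) \prod_(a <- t) w a.

Lemma legsum0 (R : comNzRingType) (K : finType) (w : K -> R) (c : K) :
  legsum w 0 c = 1.
Proof.
rewrite /legsum (big_pred1 [tuple]) ?big_nil // => t.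
by rewrite [t]tuple0 /=; apply/esym/eqP.
Qed.

(** The first vertex of the leg takes any colour but [c]; this is written as a
    difference because the sum over all the colours does not depend on [c]. *)
Lemma legsumS (R : comNzRingType) (K : finType) (w : K -> R) k (c : K) :
  legsum w k.+1 c = \sum_b w b * legsum w k b - w c * legsum w k c.
Proof.
transitivity (\sum_(b | b != c) w b * legsum w k b); last first.
  by rewrite [in RHS](bigD1 c) //= addrAC subrr add0r.
rewrite /legsum.
under [RHS]eq_bigr => b _ do rewrite mulr_sumr.
rewrite pair_big_dep /=.
rewrite (reindex (fun p : K * k.-tuple K => [tuple of p.1 :: p.2])) /=.
  by apply: eq_big => [[b t]|[b t] _] /=; rewrite ?big_cons // eq_sym.
exists (fun t : k.+1.-tuple K => (thead t, [tuple of behead t])).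
  by move=> [b t] _ /=; rewrite theadE; congr (_, _); apply/val_inj.
by move=> t _ /=; rewrite [RHS]tuple_eta.
Qed.

Local Notation leg_colours la K :=
  (fprod (fun i : 'I_(size la) => (nth 0%N la i).-tuple K)).

Definition leg_vertex (la : seq nat) (i : 'I_(size la))
    (j : 'I_(nth 0%N la i)) : spider la :=
  Some (Tagged (fun i : 'I_(size la) => 'I_(nth 0%N la i)) j).

Definition glue (la : seq nat) (K : finType) (p : K * leg_colours la K) :
    {ffun spider la -> K} :=
  [ffun v : spider_vertex la =>
    if v is Some y then tnth (p.2 (tag y)) (tagged y) else p.1].

Lemma glue_bij (la : seq nat) (K : finType) : bijective (@glue la K).
Proof.
exists (fun kappa : {ffun spider la -> K} =>
  (kappa (None : spider_vertex la),
   fprod_of_fun (fun i : 'I_(size la) =>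
     [tuple kappa (leg_vertex j) | j < nth 0%N la i]))).
  move=> [c h] /=; congr (_, _); first by rewrite ffunE.
  apply/fprodP => i; rewrite fprodE; apply: eq_from_tnth => j.
  by rewrite tnth_mktuple ffunE.
move=> kappa; apply/ffunP => -[[i j]|]; rewrite ffunE //=.
by rewrite fprodE tnth_mktuple.
Qed.

Lemma proper_glue (la : seq nat) (K : finType) c (h : leg_colours la K) :
  proper_on (glue (c, h)) = [forall i, path (fun a b => a != b) c (h i)].
Proof.
apply/forallP/forallP => [H i|H u].
  apply/(pathP c) => j; rewrite size_tuple => jl.
  case: j jl => [|j] jl /=.
    have /forallP/(_ (leg_vertex (Ordinal jl))) := H None.
    by rewrite /= /spider_adj /= !ffunE /= (tnth_nth c).
  have /forallP/(_ (leg_vertex (Ordinal jl))) :=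
    H (leg_vertex (Ordinal (ltnW jl))).
  by rewrite /= /spider_adj /= !ffunE /= !eqxx /= !(tnth_nth c).
have arc (v v' : spider la) :
    spider_arc v v' -> glue (c, h) v != glue (c, h) v'.
  move: v v' => [[i j]|] [[i' j']|] //=; rewrite !ffunE /=.
    case/andP => /eqP ii; rewrite -ii in j' * => /eqP jj.
    have /(pathP c)/(_ j.+1) := H i.
    by rewrite size_tuple -jj ltn_ord => /(_ isT); rewrite !(tnth_nth c) /= jj.
  move/eqP => j0; have /(pathP c)/(_ 0%N) := H i'.
  by rewrite size_tuple -{1}j0 ltn_ord => /(_ isT); rewrite /= (tnth_nth c) j0.
by apply/forallP => v; apply/implyP => /orP[/arc //|/arc]; rewrite eq_sym.
Qed.

(** Once the centre is coloured, the legs are coloured independently. *)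
Lemma spider_colour_sum (la : seq nat) (R : comNzRingType) (K : finType)
    (w : K -> R) :
  \sum_(kappa : {ffun spider la -> K} | proper_on kappa) \prod_v w (kappa v) =
  \sum_c w c * \prod_(l <- la) legsum w l c.
Proof.
rewrite (reindex (@glue la K)) /=; last exact/onW_bij/glue_bij.
under [RHS]eq_bigr => c _.
  rewrite (big_nth 0%N) big_mkord /legsum.
  under eq_bigr => i _ do rewrite big_mkcond.
  rewrite prod_sum_fprod mulr_sumr.
  over.
rewrite pair_big big_mkcond; apply: eq_bigr => -[c h] _ /=.
rewrite proper_glue.
case: ifP => [/forallP H|/negbT/forallPn[i /negbTE Hi]]; last first.
  by rewrite (bigD1 i) //= Hi mul0r mulr0.
rewrite (bigD1 (None : spider_vertex la)) //= ffunE /=; congr (_ * _).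
rewrite (reindex_omap Some id) => [|[y|]] //=.
transitivity (\prod_(y : {i : 'I_(size la) & 'I_(nth 0%N la i)})
  w (tnth (h (tag y)) (tagged y))).
  by apply: eq_big => [y|y _]; rewrite ?eqxx // ffunE.
rewrite -(sig_big_dep (fun=> true) (fun _ _ => true)
  (fun (i : 'I_(size la)) (j : 'I_(nth 0%N la i)) => w (tnth (h i) j))) /=.
by apply: eq_bigr => i _; rewrite H big_tuple.
Qed.

(** * The value of a spider *)

Lemma sum_nth_seq (R : nmodType) (S : nmodType) (xs : seq R) (f : R -> S) :
  \sum_(i < size xs) f xs`_i = \sum_(z <- xs) f z.
Proof. by rewrite (big_nth 0) big_mkord. Qed.

(** By induction from the centre outwards, using that [sum_horner_ecoef] sends
    Q_k to [path_matching e k.+1]: the term with p_n does not show up as long as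
    the degree k of Q_k is less than n - 1. *)
Lemma legsum_legpoly (F : numFieldType) (e : F) n (xs : seq F) k
    (c : 'I_(size xs)) :
  (2 < n)%N -> esym_gen xs = \poly_(i < n) ecoef e i -> (k < n)%N ->
  legsum (fun i : 'I_(size xs) => xs`_i) k c = (legpoly e k).[- xs`_c].
Proof.
move=> n2 xsE; elim: k c => [|k IH] c kn; first by rewrite legsum0 /= hornerC.
have kn' := ltnW kn.
rewrite legsumS IH // hornerD hornerC hornerMX mulrN [_ * xs`_c]mulrC.
congr (_ - _); under eq_bigr do rewrite IH //.
rewrite (sum_nth_seq xs (fun z => z * (legpoly e k).[- z])).
rewrite (sum_horner_ecoef n2 xsE) ?size_legpoly //.
rewrite [_`_n.-1]nth_default ?mulr0 ?subr0; last first.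
  by rewrite size_legpoly ltn_predRL.
rewrite coef0_legpoly; case: k {IH kn kn'} => [|k].
  by rewrite coef1 addr0 mulr1.
by rewrite coef1_legpoly.
Qed.

(** The product of the Q_l over the legs is monic of degree n - 1, so that p_n
    contributes with coefficient 1. *)
Lemma spider_value (F : numFieldType) (e : F) (la : seq nat) (xs : seq F)
    (n := (sumn la).+1) (q := \prod_(l <- la) legpoly e l) :
  (2 < n)%N -> esym_gen xs = \poly_(i < n) ecoef e i ->
  evaluates (nth 0 xs) (chromsym (spider la))
    (e * q`_0 + q`_1 - n%:R * ecoef e n).
Proof.
move=> n2 xsE; apply: evaluates_ext (evaluates_chromsym xs _) _.
pose w (i : 'I_(size xs)) := xs`_i; rewrite (spider_colour_sum la w).
have legsE c : \prod_(l <- la) legsum w l c = q.[- xs`_c].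
  rewrite horner_prod; apply: eq_big_seq => l lla.
  apply: legsum_legpoly n2 xsE _; rewrite ltnS.
  by rewrite sumnE (big_rem l) //= leq_addr.
under eq_bigr do rewrite legsE.
rewrite (sum_nth_seq xs (fun z => z * q.[- z])).
have qmonic : q \is monic by apply: monic_prod => l _; apply: monic_legpoly.
have qsize : size q = n.
  rewrite /n /q; elim: (la) => [|l r IH]; first by rewrite big_nil size_poly1.
  rewrite big_cons size_monicM ?monic_legpoly //; last first.
    by rewrite -size_poly_gt0 IH.
  by rewrite size_legpoly IH addnS.
rewrite (sum_horner_ecoef n2 xsE) ?qsize // -qsize -/(lead_coef q).
by rewrite (monicP qmonic) mulr1.
Qed.

(** The left-hand side is O(e^2), as there are at least 3 odd legs, and the
    right-hand side is at least e / (n - 1)!. *)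
Lemma exists_small_parameter (F : numFieldType) (la : seq nat)
    (q := fun e : F => \prod_(l <- la) legpoly e l) (n := (sumn la).+1) :
  (2 < count odd la)%N ->
  exists2 e : F, 0 <= e & e * (q e)`_0 + (q e)`_1 < n%:R * ecoef e n.
Proof.
(* C is chosen such that the left-hand side is at most C e times the lower bound
   e / (n - 1)! of the right-hand side. *)
move=> odd3; pose C := ((size la).+1 * 2 ^ sumn la * (sumn la)`!)%N.
pose e : F := C.+1%:R^-1.
have e0 : 0 < e by rewrite invr_gt0 ltr0n.
have e1 : e <= 1 by rewrite invf_le1 ?ltr0n // ler1n.
have e01 : 0 <= e <= 1 by rewrite e1 ltW.
exists e; first exact: ltW.
have [q0 q1] := prod_legpoly_bounds la e01.
have q0' : e * (q e)`_0 <= e ^+ 2 * 2 ^+ sumn la.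
  rewrite expr2 -mulrA ler_wpM2l ?(ltW e0) //.
  apply: le_trans q0 _; rewrite ler_wpM2r ?exprn_ge0 //.
  by rewrite -[leRHS]expr1 ler_wiXn2l ?(ltW e0) // (leq_trans _ odd3).
have q1' : (q e)`_1 <= (size la)%:R * e ^+ 2 * 2 ^+ sumn la.
  apply: le_trans q1 _; rewrite ler_wpM2r ?exprn_ge0 // ler_wpM2l //.
  by rewrite ler_wiXn2l ?(ltW e0) // -ltnS prednK // (leq_trans _ odd3).
have lower : e / (sumn la)`!%:R <= n%:R * ecoef e n.
  apply: le_trans (ler_wpM2l (ler0n _ n) (ecoef_ge n (ltW e0) e1)).
  by rewrite factS natrM invfM mulrCA mulVKf // pnatr_eq0.
apply: le_lt_trans (lerD q0' q1') (lt_le_trans _ lower).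
rewrite [ltLHS](_ : _ = e * ((size la).+1%:R * 2 ^+ sumn la * e)); last first.
  by rewrite -natr1; ring.
rewrite ltr_pM2l // -[ltRHS]mul1r ltr_pdivlMr ?ltr0n ?fact_gt0 //.
rewrite [ltLHS](_ : _ = C%:R / C.+1%:R); last first.
  by rewrite /C !natrM natrX -/e; ring.
by rewrite ltr_pdivrMr ?ltr0n // mul1r ltr_nat.
Qed.

Local Close Scope ring_scope.

Theorem corollary16 (la : seq nat) (la_part : is_part la)
    (la_spider : 3 <= size la) (la_odd : 3 <= count odd la) :
  ~ e_positive (spider la).
Proof.
move=> Xpos; pose n := (sumn la).+1.
have n2 : 2 < n.
  apply/ltnW/(leq_trans la_odd); elim: (la) => //= l r IH; apply: leq_add => //.
  by case: l => //= l; case: odd.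
have [e e0 small] := exists_small_parameter algC la_odd.
have [xs xsE] : exists xs, esym_gen xs = (\poly_(i < n) ecoef e i)%R.
  by apply: exists_esym_gen; rewrite coef_poly.
have xs_ge0 k : (0 <= (esym_gen xs)`_k)%R.
  by rewrite xsE coef_poly; case: ifP; rewrite ?ecoef_ge0.
have := e_positive_ge0 Xpos xs_ge0 (spider_value n2 xsE).
by rewrite subr_ge0 => /(lt_le_trans small); rewrite ltxx.
Qed.
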